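(* Assume $\varepsilon>2M$. Let $m>0$, $\phi_1\in(0,\pi)$ and $\phi_2\in(-\pi,0)$. Put $\alpha_1=|\alpha_1|e^{i\phi_1}$, $\alpha_2=|\alpha_2|e^{i\phi_2}$ with $|\alpha_2|=m|\alpha_1|$. Then, as $|\alpha_1|\to\infty$ (within $\mathcal{D}_{+-}$), $$I_{+-}^{\varepsilon}(\alpha_1,\alpha_2)\sim\frac{1}{|\alpha_1|^{\nu+3/2}}\,I_{+-}^{0}\bigl(e^{i\phi_1},me^{i\phi_2}\bigr),$$ where $I_{+-}^{0}(e^{i\phi_1},me^{i\phi_2})=\int_{3\pi/2}^{2\pi}\frac{f(\pi/2,\varphi)}{\left(-i(e^{i\phi_1}\cos\varphi+me^{i\phi_2}\sin\varphi)\right)^{\nu+3/2}}\,d\varphi$ is the (well-defined) integral obtained by setting $\varepsilon=0$. Here $\sim$ means leading-order behaviour: $|\alpha_1|^{\nu+3/2}I_{+-}^{\varepsilon}(\alpha_1,\alpha_2)\to I_{+-}^{0}(e^{i\phi_1},me^{i\phi_2})$.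
   Context: Contours and half-planes. For $j=1,2$, $\mathcal{A}_j$ is an integration contour in the complex $\alpha_j$-plane running from $-\infty$ to $+\infty$, which coincides with the real axis outside a bounded (indented) part. $\mathrm{UHP}_j$ denotes the set of points lying on and above $\mathcal{A}_j$, $\mathrm{LHP}_j$ the set of points lying on and below $\mathcal{A}_j$, and $\mathcal{D}_{+-}=\mathrm{UHP}_1\times\mathrm{LHP}_2$. The constant $M>0$ is such that $\operatorname{Im}\alpha_1\ge -M$ for all $\alpha_1\in\mathrm{UHP}_1$ and $\operatorname{Im}\alpha_2\le M$ for all $\alpha_2\in\mathrm{LHP}_2$. Eigenfunction and exponent. Let $\ell_1$ be the first (smallest) eigenvalue of (minus) the Laplace-Beltrami operator on the unit sphere, with spherical coordinates $(\theta,\varphi)$, with Dirichlet condition on the cut $\{\theta=\pi/2,\ \varphi\in[0,\pi/2]\}$; let $f(\theta,\varphi)$ be the associated first eigenfunction, and $\nu=\sqrt{\ell_1+1/4}\approx 0.7967$. The following properties of $f$ are taken as known: $f(\pi/2,\varphi)=0$ for $\varphi\in[0,\pi/2]$; $f(\pi/2,\cdot)$ is smooth with $0<f(\pi/2,\varphi)\le 1$ on $(\pi/2,2\pi)$; $f(\pi/2,\varphi)=\mathcal{O}(\sqrt{\varphi-\pi/2})$ as $\varphi\to\pi/2^+$ and $\mathcal{O}(\sqrt{2\pi-\varphi})$ as $\varphi\to 2\pi^-$; $f(\pi/2,\cdot)$ is strictly decreasing on $[3\pi/2,2\pi]$. The integral. For $(\alpha_1,\alpha_2)\in\mathcal{D}_{+-}$,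 $$I_{+-}^{\varepsilon}(\alpha_1,\alpha_2)=\int_{\frac{3\pi}{2}}^{2\pi}\frac{f\left(\frac{\pi}{2},\varphi\right)}{\bigl(-i(\alpha_1\cos\varphi+\alpha_2\sin\varphi+i\varepsilon)\bigr)^{\nu+3/2}}\,d\varphi .$$ Complex powers $\mu^{\nu+3/2}$ with $\operatorname{Re}\mu>0$ are principal values. *)

(* Defs.v *)
From Stdlib Require Import Reals.
From Coquelicot Require Import Coquelicot.
Open Scope R_scope.

(* ---------- Contours and half-planes ---------- *)

(* A simple curve running from -oo to +oo, parametrized so that the part lying
   outside the bounded indentation is the identity of the real axis. *)
Definition indented_contour (gamma : R -> C) : Prop :=
  (forall t : R, continuous gamma t) /\
  (forall s t : R, gamma s = gamma t -> s = t) /\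
  (exists T : R, forall t : R, T <= Rabs t -> gamma t = RtoC t).

Definition on_contour (gamma : R -> C) (z : C) : Prop :=
  exists t : R, gamma t = z.

(* z can be joined to infinity, with Im tending to [l], without meeting the
   contour.  With l = p_infty (resp. m_infty) this singles out the component of
   the complement lying above (resp. below) the contour. *)
Definition escapes (gamma : R -> C) (l : Rbar) (z : C) : Prop :=
  exists p : R -> C,
    p 0 = z /\
    (forall t : R, continuous p t) /\
    (forall t : R, 0 <= t -> ~ on_contour gamma (p t)) /\
    is_lim (fun t => Im (p t)) p_infty l.

Definition UHP (gamma : R -> C) (z : C) : Prop :=
  on_contour gamma z \/ escapes gamma p_infty z.

Definition LHP (gamma : R -> C) (z : C) : Prop :=
  on_contour gamma z \/ escapes gamma m_infty z.

Definition Dpm (gamma1 gamma2 : R -> C) (a1 a2 : C) : Prop :=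
  UHP gamma1 a1 /\ LHP gamma2 a2.

(* ---------- Laplace-Beltrami eigenfunctions on the slit sphere ---------- *)

Definition R3 : Type := (R * R * R)%type.

Definition spherical (r theta phi : R) : R3 :=
  (r * (sin theta * cos phi), r * (sin theta * sin phi), r * cos theta).

Definition translate (p e : R3) (t : R) : R3 := plus p (scal t e).

Definition dir_derive (e : R3) (F : R3 -> R) (p : R3) : R :=
  Derive (fun t => F (translate p e t)) 0.

Definition C1_on (O : R3 -> Prop) (F : R3 -> R) : Prop :=
  forall e p : R3, O p ->
    ex_derive (fun t => F (translate p e t)) 0 /\ continuous (dir_derive e F) p.

Definition C2_on (O : R3 -> Prop) (F : R3 -> R) : Prop :=
  C1_on O F /\ forall e : R3, C1_on O (dir_derive e F).

Definition laplacian (F : R3 -> R) (p : R3) : R :=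
  dir_derive (1, 0, 0) (dir_derive (1, 0, 0) F) p
  + dir_derive (0, 1, 0) (dir_derive (0, 1, 0) F) p
  + dir_derive (0, 0, 1) (dir_derive (0, 0, 1) F) p.

(* The complement in R^3 of the closed quarter-plane {x >= 0, y >= 0, z = 0},
   which is the cone over the cut {theta = PI/2, 0 <= phi <= PI/2}. *)
Definition off_cut (p : R3) : Prop :=
  let '(x, y, z) := p in ~ (0 <= x /\ 0 <= y /\ z = 0).

Definition on_unit_sphere (p : R3) : Prop :=
  let '(x, y, z) := p in x ^ 2 + y ^ 2 + z ^ 2 = 1.

(* f(theta, phi) is a (classical, real) Dirichlet eigenfunction, with eigenvalue
   lambda, of minus the Laplace-Beltrami operator on the unit sphere slit along
   the cut.  F is the extension of f to R^3 \ {0} that is constant along rays;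
   on the unit sphere, laplacian F is the Laplace-Beltrami operator applied to
   f.  Working with F rather than with f avoids the coordinate singularities at
   theta = 0 and theta = PI; the first condition makes f 2*PI-periodic in phi
   and independent of phi at the poles. *)
Definition dirichlet_eigenfunction (lambda : R) (f : R -> R -> R) : Prop :=
  exists F : R3 -> R,
    (forall r theta phi : R, 0 < r -> 0 <= theta <= PI ->
       F (spherical r theta phi) = f theta phi) /\
    (forall p : R3, p <> (0, 0, 0) -> continuous F p) /\
    C2_on off_cut F /\
    (forall p : R3, on_unit_sphere p -> off_cut p ->
       - laplacian F p = lambda * F p) /\
    (forall phi : R, 0 <= phi <= PI / 2 -> f (PI / 2) phi = 0) /\
    (exists theta phi : R, 0 <= theta <= PI /\ f theta phi <> 0).

Definition first_eigenfunction (l1 : R) (f : R -> R -> R) : Prop :=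
  dirichlet_eigenfunction l1 f /\
  (forall (lambda : R) (g : R -> R -> R),
     dirichlet_eigenfunction lambda g -> l1 <= lambda).

(* The properties of g = f(PI/2, .) that are taken as known. *)
Definition known_properties (g : R -> R) : Prop :=
  (forall phi : R, 0 <= phi <= PI / 2 -> g phi = 0) /\
  (forall (n : nat) (phi : R), PI / 2 < phi < 2 * PI -> ex_derive_n g n phi) /\
  (forall phi : R, PI / 2 < phi < 2 * PI -> 0 < g phi <= 1) /\
  (exists K : R, at_right (PI / 2)
     (fun phi => Rabs (g phi) <= K * sqrt (phi - PI / 2))) /\
  (exists K : R, at_left (2 * PI)
     (fun phi => Rabs (g phi) <= K * sqrt (2 * PI - phi))) /\
  (forall phi psi : R, 3 * PI / 2 <= phi -> phi < psi -> psi <= 2 * PI ->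
     g psi < g phi).

(* ---------- The integral ---------- *)

(* cis x = exp (i x) *)
Definition cis (x : R) : C := (cos x, sin x).

(* Principal value of z^s; the formula for the argument is valid for Re z > 0,
   the only case in which it is used. *)
Definition Cpower (z : C) (s : R) : C :=
  Cmult (RtoC (Rpower (Cmod z) s)) (cis (s * atan (Im z / Re z))).

Definition Ipm_base (eps : R) (a1 a2 : C) (phi : R) : C :=
  (- Ci * (a1 * RtoC (cos phi) + a2 * RtoC (sin phi) + Ci * RtoC eps))%C.

Definition Ipm_integrand (f : R -> R -> R) (nu eps : R) (a1 a2 : C)
    (phi : R) : C :=
  Cdiv (RtoC (f (PI / 2) phi)) (Cpower (Ipm_base eps a1 a2 phi) (nu + 3 / 2)).

Definition Ipm (f : R -> R -> R) (nu eps : R) (a1 a2 : C) : C :=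
  RInt (V := C_R_CompleteNormedModule)
    (Ipm_integrand f nu eps a1 a2) (3 * PI / 2) (2 * PI).

(* [RInt] is total; this says that [Ipm] is a genuine integral of a genuine
   principal power. *)
Definition Ipm_well_defined (f : R -> R -> R) (nu eps : R) (a1 a2 : C) : Prop :=
  (forall phi : R, 3 * PI / 2 <= phi <= 2 * PI ->
     0 < Re (Ipm_base eps a1 a2 phi)) /\
  ex_RInt (V := C_R_NormedModule)
    (Ipm_integrand f nu eps a1 a2) (3 * PI / 2) (2 * PI).

(* Main.v *)
Require Import Defs.
From Stdlib Require Import Reals Lra.
From Coquelicot Require Import Coquelicot.
Open Scope R_scope.

(** The limit is a scaling argument followed by continuous dependence of an
    integral on a parameter.  The base of the power in the integrand is
    homogeneous of degree one in (alpha_1, alpha_2, epsilon) jointly, and the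
    principal power is homogeneous under positive factors; so, for r = |alpha_1|,
    the rescaled integral r^(nu + 3/2) I^eps is exactly the integral at the fixed
    unit-size point (e^(i phi_1), m e^(i phi_2)) with eps replaced by eps / r
    ([Ipm_scale]).  It remains to let eps / r tend to 0 under the integral sign.

    The base has real part eps + Im alpha_1 cos phi + Im alpha_2 sin phi, where
    cos phi >= 0 >= sin phi on the range of integration.  On the domain D_{+-}
    this is at least eps - 2 M > 0.  At the limit point, with eps = 0, both
    remaining terms are nonnegative, and they do not vanish together because
    sin phi_1 > 0 > sin phi_2.  The base thus stays in the open right half-plane,
    where the principal power is continuous; the eigenfunction is continuous up
    to the slit, being the restriction to the sphere of a continuous function on
    R^3 minus the origin.  The integrand is therefore jointly continuous in the
    parameter and in phi over a compact range, which gives both the existence of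
    the integrals and the passage to the limit ([RInt_param_filterlim]). *)

(** * Continuity of complex-valued functions *)

Lemma continuous_C_components {U : UniformSpace} (z : U -> C) (x : U) :
  continuous (fun u => Re (z u)) x -> continuous (fun u => Im (z u)) x ->
  continuous z x.
Proof.
  intros H1 H2.
  apply continuous_ext with (fun u => (Re (z u), Im (z u))).
  - intros u. now destruct (z u).
  - apply (continuous_comp_2 (fun u => Re (z u)) (fun u => Im (z u))
             (fun a b : R => (a, b)) x H1 H2).
    apply continuous_ext with (fun p : R * R => p).
    + now intros [a b].
    + apply continuous_id.
Qed.

Lemma continuous_Re {U : UniformSpace} (z : U -> C) (x : U) :
  continuous z x -> continuous (fun u => Re (z u)) x.
Proof.
  intros H. apply (continuous_comp z (fun w : R * R => fst w) x H).
  destruct (z x) as [a b]. apply continuous_fst.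
Qed.

Lemma continuous_Im {U : UniformSpace} (z : U -> C) (x : U) :
  continuous z x -> continuous (fun u => Im (z u)) x.
Proof.
  intros H. apply (continuous_comp z (fun w : R * R => snd w) x H).
  destruct (z x) as [a b]. apply continuous_snd.
Qed.

Lemma continuous_Rmult {U : UniformSpace} (u v : U -> R) (x : U) :
  continuous u x -> continuous v x -> continuous (fun y => u y * v y) x.
Proof. exact (continuous_mult u v x). Qed.

Lemma continuous_Rplus {U : UniformSpace} (u v : U -> R) (x : U) :
  continuous u x -> continuous v x -> continuous (fun y => u y + v y) x.
Proof. exact (continuous_plus u v x). Qed.

Lemma continuous_Ropp {U : UniformSpace} (u : U -> R) (x : U) :
  continuous u x -> continuous (fun y => - u y) x.
Proof. exact (continuous_opp u x). Qed.

Lemma continuous_Cmod {U : UniformSpace} (z : U -> C) (x : U) :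
  continuous z x -> continuous (fun u => Cmod (z u)) x.
Proof.
  intros H. unfold Cmod.
  apply (continuous_comp (fun u => fst (z u) ^ 2 + snd (z u) ^ 2) sqrt).
  - apply continuous_ext with
      (fun u => Re (z u) * Re (z u) + Im (z u) * Im (z u)).
    + intros u.
      change (Re (z u) * Re (z u) + Im (z u) * Im (z u)
              = Re (z u) ^ 2 + Im (z u) ^ 2).
      ring.
    + apply continuous_Rplus; apply continuous_Rmult;
        first [now apply continuous_Re | now apply continuous_Im].
  - apply continuous_sqrt.
Qed.

(** * The principal power on the right half-plane *)

Lemma Re_pos_neq0 (z : C) : 0 < Re z -> z <> RtoC 0.
Proof. intros H E. rewrite E in H. simpl in H. lra. Qed.

(** Writing the reciprocal as a power makes the integrand a product of continuous
    factors. *)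
Lemma Cpower_opp (z : C) (s : R) : Cinv (Cpower z s) = Cpower z (- s).
Proof.
  unfold Cpower. rewrite Rpower_Ropp.
  assert (Hp : 0 < Rpower (Cmod z) s) by apply exp_pos.
  revert Hp. generalize (Rpower (Cmod z) s). intros q Hq.
  rewrite Ropp_mult_distr_l_reverse.
  generalize (s * atan (Im z / Re z)). intros t.
  assert (E : Rsqr (sin t) + Rsqr (cos t) = 1) by apply sin2_cos2.
  unfold Rsqr in E.
  unfold cis. rewrite cos_neg, sin_neg.
  unfold Cinv, Cmult, RtoC; simpl.
  replace ((q * cos t - 0 * sin t) * ((q * cos t - 0 * sin t) * 1) +
           (q * sin t + 0 * cos t) * ((q * sin t + 0 * cos t) * 1))
    with (q * q * (sin t * sin t + cos t * cos t)) by ring.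
  rewrite E. f_equal; field; lra.
Qed.

Lemma Cpower_scale (r : R) (z : C) (s : R) :
  0 < r -> 0 < Re z ->
  Cpower (Cmult (RtoC r) z) s = Cmult (RtoC (Rpower r s)) (Cpower z s).
Proof.
  intros Hr Hz. unfold Cpower.
  (* A positive factor leaves the quotient Im / Re, hence the argument, alone. *)
  rewrite Cmod_mult, Cmod_R, (Rabs_pos_eq r) by lra.
  rewrite <- Rpower_mult_distr; [ | exact Hr | now apply Cmod_gt_0, Re_pos_neq0].
  replace (Im (RtoC r * z) / Re (RtoC r * z)) with (Im z / Re z).
  - rewrite RtoC_mult. ring.
  - unfold Re, Im in *. simpl. field. lra.
Qed.

Lemma continuous_Cpower {U : UniformSpace} (z : U -> C) (s : R) (x : U) :
  continuous z x -> 0 < Re (z x) -> continuous (fun u => Cpower (z u) s) x.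
Proof.
  intros Hz Hpos.
  assert (Hmod : continuous (fun u => Rpower (Cmod (z u)) s) x).
  { unfold Rpower.
    apply (continuous_comp (fun u => s * ln (Cmod (z u))) exp);
      [ | apply continuous_exp].
    apply continuous_Rmult; [apply continuous_const | ].
    apply (continuous_comp (fun u => Cmod (z u)) ln).
    - now apply continuous_Cmod.
    - apply continuous_ln. now apply Cmod_gt_0, Re_pos_neq0. }
  assert (Harg : continuous (fun u => s * atan (Im (z u) / Re (z u))) x).
  { apply continuous_Rmult; [apply continuous_const | ].
    apply (continuous_comp (fun u => Im (z u) / Re (z u)) atan);
      [ | apply continuous_atan].
    apply continuous_Rmult; [now apply continuous_Im | ].
    apply (continuous_comp (fun u => Re (z u)) Rinv).
    - now apply continuous_Re.
    - apply continuous_Rinv. lra. }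
  apply continuous_C_components; unfold Cpower.
  - apply continuous_ext with (fun u =>
      Rpower (Cmod (z u)) s * cos (s * atan (Im (z u) / Re (z u)))).
    + intros u. simpl. ring.
    + apply continuous_Rmult; [exact Hmod | ].
      apply (continuous_comp _ cos x Harg). apply continuous_cos.
  - apply continuous_ext with (fun u =>
      Rpower (Cmod (z u)) s * sin (s * atan (Im (z u) / Re (z u)))).
    + intros u. simpl. ring.
    + apply continuous_Rmult; [exact Hmod | ].
      apply (continuous_comp _ sin x Harg). apply continuous_sin.
Qed.

(** * Integrals depending on a parameter *)

(** Joint continuity along the compact segment over [x0] makes [h x] converge to
    [h x0] uniformly there.  The uniformity comes from applying the
    uniform-continuity theorem to the single real function
    (t, x) |-> |h x t - h x0 t|, which vanishes for x = x0. *)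
Lemma RInt_param_filterlim {T : Type} (F : (T -> Prop) -> Prop) {FF : Filter F}
    (h : R -> R -> C) (d : T -> R) (a b x0 : R) :
  a <= b ->
  (forall t, a <= t <= b ->
     continuous (fun p : R * R => h (fst p) (snd p)) (x0, t)) ->
  ex_RInt (V := C_R_NormedModule) (h x0) a b ->
  F (fun y => ex_RInt (V := C_R_NormedModule) (h (d y)) a b) ->
  filterlim d F (locally x0) ->
  filterlim (fun y => RInt (V := C_R_CompleteNormedModule) (h (d y)) a b) F
    (locally (RInt (V := C_R_CompleteNormedModule) (h x0) a b)).
Proof.
  intros Hab Hc Hex0 Hex Hd.
  apply (filterlim_locally_ball_norm (U := C_R_NormedModule)). intros e.
  set (D := fun t x => Cmod (h x t - h x0 t)%C).
  assert (HD : forall t, a <= t <= b -> continuity_2d_pt D t x0).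
  { intros t Ht. apply continuity_2d_pt_filterlim. unfold D.
    apply (continuous_Cmod
             (fun p : R * R => (h (snd p) (fst p) - h x0 (fst p))%C) (t, x0)).
    apply (continuous_minus (V := C_R_NormedModule)
             (fun p : R * R => h (snd p) (fst p))
             (fun p : R * R => h x0 (fst p)) (t, x0)).
    - apply (continuous_comp_2 (fun p : R * R => snd p) (fun p : R * R => fst p) h).
      + apply continuous_snd.
      + apply continuous_fst.
      + now apply Hc.
    - apply (continuous_comp_2 (fun _ : R * R => x0) (fun p : R * R => fst p) h).
      + apply continuous_const.
      + apply continuous_fst.
      + now apply Hc. }
  (* The factor b - a + 1 keeps the divisor positive when a = b. *)
  assert (He : 0 < e / (b - a + 1)).
  { apply Rdiv_lt_0_compat; [apply cond_pos | lra]. }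
  destruct (uniform_continuity_2d_1d D a b x0 HD (mkposreal _ He))
    as [delta Hdelta].
  assert (Hnear := proj1 (filterlim_locally _ _) Hd delta).
  generalize (filter_and _ _ Hex Hnear). apply filter_imp.
  intros y [Hy Hball].
  change (Rabs (d y - x0) < delta) in Hball.
  apply Rabs_lt_between in Hball.
  unfold ball_norm.
  assert (Hint : is_RInt (V := C_R_NormedModule)
            (fun t => minus (h (d y) t) (h x0 t)) a b
            (minus (RInt (V := C_R_CompleteNormedModule) (h (d y)) a b)
                   (RInt (V := C_R_CompleteNormedModule) (h x0) a b))).
  { apply (is_RInt_minus (V := C_R_NormedModule));
      apply (RInt_correct (V := C_R_CompleteNormedModule)); assumption. }
  eapply Rle_lt_trans.
  - apply (norm_RInt_le_const (V := C_R_NormedModule)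
             (fun t => minus (h (d y) t) (h x0 t)) a b _ (e / (b - a + 1)) Hab);
      [ | exact Hint].
    intros t Ht.
    assert (Hpos := cond_pos delta).
    assert (Hu := Hdelta t x0 t (d y) Ht ltac:(lra) Ht ltac:(lra)).
    rewrite Rminus_diag, Rabs_R0 in Hu. specialize (Hu Hpos).
    unfold D in Hu. simpl in Hu.
    replace (h x0 t - h x0 t)%C with (RtoC 0) in Hu by ring.
    rewrite Cmod_0, Rminus_0_r, Rabs_pos_eq in Hu by apply Cmod_ge_0.
    rewrite <- Cmod_norm. apply Rlt_le. exact Hu.
  - apply Rlt_le_trans with ((b - a + 1) * (e / (b - a + 1))).
    + apply Rmult_lt_compat_r; lra.
    + right. field. lra.
Qed.

(** * The integrand *)

Lemma Re_Ipm_base (eps : R) (a1 a2 : C) (phi : R) :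
  Re (Ipm_base eps a1 a2 phi) = eps + Im a1 * cos phi + Im a2 * sin phi.
Proof. unfold Ipm_base, Re, Im. simpl. ring. Qed.

Lemma Im_Ipm_base (eps : R) (a1 a2 : C) (phi : R) :
  Im (Ipm_base eps a1 a2 phi) = - (Re a1 * cos phi + Re a2 * sin phi).
Proof. unfold Ipm_base, Re, Im. simpl. ring. Qed.

Lemma cos_sin_fourth_quadrant (phi : R) :
  3 * PI / 2 <= phi <= 2 * PI ->
  0 <= cos phi <= 1 /\ -1 <= sin phi <= 0.
Proof.
  intros H. assert (Hpi := PI_RGT_0).
  assert (Hc : 0 <= cos phi) by (apply cos_ge_0_3PI2; lra).
  assert (Hs : sin phi <= 0) by (apply sin_le_0; lra).
  assert (B1 := COS_bound phi). assert (B2 := SIN_bound phi). lra.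
Qed.

(** The values on the plane of the slit are those of the continuous ray-constant
    extension along the unit circle, on and off the slit alike. *)
Lemma eigenfunction_equator_continuous (lambda : R) (f : R -> R -> R) :
  dirichlet_eigenfunction lambda f ->
  forall phi, continuous (f (PI / 2)) phi.
Proof.
  intros (F & HF & Hcont & _) phi.
  assert (Hpi := PI_RGT_0).
  apply continuous_ext with (fun x => F (spherical 1 (PI / 2) x)).
  { intros x. apply HF; lra. }
  apply (continuous_comp (fun x => spherical 1 (PI / 2) x) F).
  - unfold spherical.
    apply (continuous_comp_2
             (fun x => (1 * (sin (PI / 2) * cos x), 1 * (sin (PI / 2) * sin x)))
             (fun _ => 1 * cos (PI / 2)) (fun p z => (p, z))).
    + apply (continuous_comp_2 (fun x => 1 * (sin (PI / 2) * cos x))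
               (fun x => 1 * (sin (PI / 2) * sin x)) (fun u v => (u, v))).
      * do 2 (apply continuous_Rmult; [apply continuous_const | ]).
        apply continuous_cos.
      * do 2 (apply continuous_Rmult; [apply continuous_const | ]).
        apply continuous_sin.
      * apply continuous_ext with (fun p : R * R => p);
          [now intros [u v] | apply continuous_id].
    + apply continuous_const.
    + apply continuous_ext with (fun p : R * R * R => p);
        [now intros [u v] | apply continuous_id].
  - apply Hcont. unfold spherical. rewrite sin_PI2. intros E.
    injection E as E1 E2 _.
    assert (E3 := sin2_cos2 phi). unfold Rsqr in E3.
    assert (sin phi = 0) by lra. assert (cos phi = 0) by lra. nra.
Qed.

Lemma Ipm_integrand_continuous (f : R -> R -> R) (nu : R)
    (f_cont : forall phi, continuous (f (PI / 2)) phi) 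
    (a1 a2 : C) (eps phi : R) :
  0 < Re (Ipm_base eps a1 a2 phi) ->
  continuous (fun p : R * R => Ipm_integrand f nu (fst p) a1 a2 (snd p))
    (eps, phi).
Proof.
  intros Hpos.
  assert (Hcos : continuous (fun p : R * R => cos (snd p)) (eps, phi)).
  { apply (continuous_comp (fun p : R * R => snd p) cos);
      [apply continuous_snd | apply continuous_cos]. }
  assert (Hsin : continuous (fun p : R * R => sin (snd p)) (eps, phi)).
  { apply (continuous_comp (fun p : R * R => snd p) sin);
      [apply continuous_snd | apply continuous_sin]. }
  assert (Hg : continuous (fun p : R * R => f (PI / 2) (snd p)) (eps, phi)).
  { apply (continuous_comp (fun p : R * R => snd p) (f (PI / 2)));
      [apply continuous_snd | apply f_cont]. }
  assert (Hbase : continuous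
            (fun p : R * R => Ipm_base (fst p) a1 a2 (snd p)) (eps, phi)).
  { apply continuous_C_components.
    - eapply continuous_ext; [intros p; symmetry; apply Re_Ipm_base | ].
      repeat apply continuous_Rplus; [apply continuous_fst | | ];
        (apply continuous_Rmult; [apply continuous_const | assumption]).
    - eapply continuous_ext; [intros p; symmetry; apply Im_Ipm_base | ].
      apply continuous_Ropp, continuous_Rplus;
        (apply continuous_Rmult; [apply continuous_const | assumption]). }
  assert (Hpow := continuous_Cpower _ (- (nu + 3 / 2)) _ Hbase Hpos).
  apply continuous_ext with (fun p : R * R =>
    Cmult (RtoC (f (PI / 2) (snd p)))
      (Cpower (Ipm_base (fst p) a1 a2 (snd p)) (- (nu + 3 / 2)))).
  { intros p. unfold Ipm_integrand, Cdiv. now rewrite Cpower_opp. }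
  apply continuous_C_components.
  - eapply continuous_ext;
      [ | apply (continuous_Rmult _ _ _ Hg (continuous_Re _ _ Hpow))].
    intros p. unfold Re. simpl. ring.
  - eapply continuous_ext;
      [ | apply (continuous_Rmult _ _ _ Hg (continuous_Im _ _ Hpow))].
    intros p. unfold Im. simpl. ring.
Qed.

Lemma Ipm_well_defined_of_Re_pos (f : R -> R -> R) (nu : R)
    (f_cont : forall phi, continuous (f (PI / 2)) phi) 
    (eps : R) (a1 a2 : C) :
  (forall phi, 3 * PI / 2 <= phi <= 2 * PI ->
     0 < Re (Ipm_base eps a1 a2 phi)) ->
  Ipm_well_defined f nu eps a1 a2.
Proof.
  intros Hpos. split; [exact Hpos | ].
  assert (Hpi := PI_RGT_0).
  apply (ex_RInt_continuous (V := C_R_CompleteNormedModule)).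
  rewrite Rmin_left, Rmax_right by lra. intros phi Hphi.
  apply (continuous_comp_2 (fun _ : R => eps) (fun t : R => t)
           (fun e t => Ipm_integrand f nu e a1 a2 t)).
  - apply continuous_const.
  - apply continuous_id.
  - apply Ipm_integrand_continuous; [exact f_cont | now apply Hpos].
Qed.

(** The base at (eps; r a1, r a2) is r times the base at (eps / r; a1, a2), and
    the principal power turns the factor r into r^(nu + 3/2). *)
Lemma Ipm_scale (f : R -> R -> R) (nu eps r : R) (a1 a2 : C) :
  0 < r ->
  Ipm_well_defined f nu (eps / r) a1 a2 ->
  Cmult (RtoC (Rpower r (nu + 3 / 2)))
    (Ipm f nu eps (Cmult (RtoC r) a1) (Cmult (RtoC r) a2))
  = Ipm f nu (eps / r) a1 a2.
Proof.
  intros Hr [Hpos Hex]. assert (Hpi := PI_RGT_0).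
  set (q := Rpower r (nu + 3 / 2)).
  assert (Hq : 0 < q) by apply exp_pos.
  assert (E : Ipm f nu eps (Cmult (RtoC r) a1) (Cmult (RtoC r) a2)
              = scal (V := C_R_ModuleSpace) (/ q) (Ipm f nu (eps / r) a1 a2)).
  { unfold Ipm.
    rewrite <- (RInt_scal (V := C_R_CompleteNormedModule) _ _ _ _ Hex).
    apply (RInt_ext (V := C_R_CompleteNormedModule)).
    rewrite Rmin_left, Rmax_right by lra. intros phi Hphi.
    assert (Hp : 0 < Re (Ipm_base (eps / r) a1 a2 phi)) by (apply Hpos; lra).
    rewrite scal_R_Cmult. unfold Ipm_integrand, Cdiv.
    rewrite !Cpower_opp.
    replace (Ipm_base eps (Cmult (RtoC r) a1) (Cmult (RtoC r) a2) phi)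
      with (Cmult (RtoC r) (Ipm_base (eps / r) a1 a2 phi)).
    - rewrite Cpower_scale, Rpower_Ropp by assumption. fold q.
      match goal with |- ?x = ?y => change (@eq C x y) end. ring.
    - unfold Ipm_base. rewrite RtoC_div by lra. field.
      intros Hc. apply RtoC_inj in Hc. lra. }
  rewrite E, scal_R_Cmult, Cmult_assoc, <- RtoC_mult, Rinv_r by lra.
  apply Cmult_1_l.
Qed.

Theorem mainTheorem2
  (gamma1 gamma2 : R -> C)
  (hgamma1 : indented_contour gamma1)
  (hgamma2 : indented_contour gamma2)
  (M : R) (hM : 0 < M)
  (hM1 : forall a1 : C, UHP gamma1 a1 -> - M <= Im a1)
  (hM2 : forall a2 : C, LHP gamma2 a2 -> Im a2 <= M)
  (l1 : R) (f : R -> R -> R)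
  (hf : first_eigenfunction l1 f)
  (hf_known : known_properties (f (PI / 2)))
  (nu : R) (hnu : nu = sqrt (l1 + 1 / 4))
  (eps : R) (heps : 2 * M < eps)
  (m : R) (hm : 0 < m)
  (phi1 phi2 : R) (hphi1 : 0 < phi1 < PI) (hphi2 : - PI < phi2 < 0) :
  (forall a1 a2 : C, Dpm gamma1 gamma2 a1 a2 ->
     Ipm_well_defined f nu eps a1 a2) /\
  Ipm_well_defined f nu 0 (cis phi1) (Cmult (RtoC m) (cis phi2)) /\
  filterlim
    (fun r : R =>
       Cmult (RtoC (Rpower r (nu + 3 / 2)))
         (Ipm f nu eps
            (Cmult (RtoC r) (cis phi1)) (Cmult (RtoC (m * r)) (cis phi2))))
    (within
       (fun r : R =>
          Dpm gamma1 gamma2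
            (Cmult (RtoC r) (cis phi1)) (Cmult (RtoC (m * r)) (cis phi2)))
       (Rbar_locally p_infty))
    (locally (Ipm f nu 0 (cis phi1) (Cmult (RtoC m) (cis phi2)))).
Proof.
  assert (Hpi := PI_RGT_0).
  assert (Hg : forall phi, continuous (f (PI / 2)) phi).
  { apply (eigenfunction_equator_continuous l1). apply hf. }
  assert (Hs1 : 0 < sin phi1) by (apply sin_gt_0; lra).
  assert (Hs2 : m * sin phi2 < 0).
  { assert (sin phi2 < 0) by (apply sin_lt_0_var; lra). nra. }
  assert (Hbase : forall d phi, 0 <= d -> 3 * PI / 2 <= phi <= 2 * PI ->
            0 < Re (Ipm_base d (cis phi1) (Cmult (RtoC m) (cis phi2)) phi)).
  { intros d phi Hd Hphi. rewrite Re_Ipm_base.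
    destruct (cos_sin_fourth_quadrant phi Hphi) as [Hc Hs].
    assert (E := sin2_cos2 phi). unfold Rsqr in E.
    replace (Im (cis phi1)) with (sin phi1) by reflexivity.
    replace (Im (Cmult (RtoC m) (cis phi2))) with (m * sin phi2)
      by (unfold Im; simpl; ring).
    assert (0 <= sin phi1 * cos phi) by nra.
    assert (0 <= m * sin phi2 * sin phi) by nra.
    (* Where cos phi = 0, sin phi = -1 and the second term is positive. *)
    destruct (Req_dec (cos phi) 0) as [E0 | E0]; [ | nra].
    rewrite E0 in *. nra. }
  assert (Hwd : forall d, 0 <= d ->
            Ipm_well_defined f nu d (cis phi1) (Cmult (RtoC m) (cis phi2))).
  { intros d Hd. apply Ipm_well_defined_of_Re_pos; [exact Hg | ].
    intros phi. now apply Hbase. }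
  assert (Hdiv : forall r, 0 < r -> 0 <= eps / r).
  { intros r Hr. apply Rlt_le, Rdiv_lt_0_compat; lra. }
  split; [ | split].
  - intros a1 a2 [H1 H2].
    apply Ipm_well_defined_of_Re_pos; [exact Hg | ].
    intros phi Hphi. rewrite Re_Ipm_base.
    destruct (cos_sin_fourth_quadrant phi Hphi) as [Hc Hs].
    assert (B1 := hM1 a1 H1). assert (B2 := hM2 a2 H2).
    assert (- M <= Im a1 * cos phi) by nra.
    assert (- M <= Im a2 * sin phi) by nra.
    lra.
  - apply Hwd. lra.
  - apply (filterlim_filter_le_1 (F := Rbar_locally p_infty)).
    { apply filter_le_within. }
    apply filterlim_ext_loc with
      (fun r => Ipm f nu (eps / r) (cis phi1) (Cmult (RtoC m) (cis phi2))).
    { exists 0. intros r Hr. rewrite <- Ipm_scale; [ | exact Hr | ].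
      - now rewrite (Rmult_comm m r), RtoC_mult, <- Cmult_assoc.
      - now apply Hwd, Hdiv. }
    unfold Ipm.
    apply (RInt_param_filterlim (Rbar_locally p_infty)
             (fun d => Ipm_integrand f nu d (cis phi1) (Cmult (RtoC m) (cis phi2)))
             (fun r => eps / r)).
    + lra.
    + intros t Ht. apply Ipm_integrand_continuous; [exact Hg | ].
      apply Hbase; [lra | exact Ht].
    + apply Hwd. lra.
    + exists 0. intros r Hr. now apply Hwd, Hdiv.
    + assert (L : is_lim (fun r => eps / r) p_infty (eps * 0)).
      { apply (is_lim_scal_l Rinv eps p_infty 0).
        apply (is_lim_inv (fun r => r) p_infty p_infty); [apply is_lim_id | easy]. }
      rewrite Rmult_0_r in L. exact L.
Qed.
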